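(* Let $T:\ell^1(\mathbb{N})\to\ell^1(\mathbb{N})$ be the right-shift operator $T(x_0,x_1,x_2,\ldots)=(0,x_0,x_1,x_2,\ldots)$, and let $\{\alpha_n\}_{n\ge0}$ be an arbitrary sequence of stepsizes in $[0,1]$. Then the Krasnosel'skiĭ–Mann iterates $$x^{n+1}=(1-\alpha_n)x^n+\alpha_n Tx^n\qquad(n\ge0)$$ started from $x^0=(1,0,0,\ldots)$ satisfy $$\|x^n-Tx^n\|_1\ \ge\ \frac{1}{\sqrt{n+1}}.$$
   Context: $\mathbb{N}=\{0,1,2,\ldots\}$ and $\ell^1(\mathbb{N})$ is the space of absolutely summable real sequences with norm $\|x\|_1=\sum_{i\ge0}|x_i|$. *)

(* Defs.v *)
From HB Require Import structures.
From mathcomp Require Import all_boot all_order all_algebra.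
From mathcomp Require Import all_classical all_reals all_analysis.

Set Implicit Arguments.
Unset Strict Implicit.
Unset Printing Implicit Defensive.

Import Order.TTheory GRing.Theory Num.Theory.
Import numFieldNormedType.Exports.

Local Open Scope classical_set_scope.
Local Open Scope ring_scope.

Definition abs_summable (R : realType) : {pred (nat -> R)} :=
  fun x => `[< cvgn [series `|x i|]_i >].

Section l1_space.
Variable R : realType.

Record l1 := L1 { l1_seq :> nat -> R; _ : l1_seq \in @abs_summable R }.

HB.instance Definition _ := [isSub for l1_seq].
HB.instance Definition _ := [Choice of l1 by <:].

Lemma abs_summableP (x : nat -> R) :
  reflect (cvgn [series `|x i|]_i) (x \in @abs_summable R).
Proof. exact: asboolP. Qed.

Lemma l1_cvg (x : l1) : cvgn [series `|x i|]_i.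
Proof. by apply/abs_summableP; exact: valP x. Qed.
Arguments l1_cvg : clear implicits.

Lemma abs_summable_finite (x : nat -> R) (N : nat) :
  (forall i, (N <= i)%N -> x i = 0) -> x \in @abs_summable R.
Proof.
move=> x0; apply/abs_summableP.
rewrite -(@is_cvg_series_restrict N).
rewrite (_ : (fun n => _) = cst 0); first exact: is_cvg_cst.
apply/funext => n; rewrite big_nat_cond big1// => i /andP[/andP[Ni _] _].
by rewrite /= x0// normr0.
Qed.

Lemma abs_summable_submod : subsemimod_closed (@abs_summable R).
Proof.
split; first split.
- by apply: (@abs_summable_finite _ 0) => i _.
- move=> x y /abs_summableP cx /abs_summableP cy; apply/abs_summableP.
  apply: series_le_cvg (is_cvg_seriesD cx cy) => // n.
  + exact: normr_ge0.
  + exact: (addr_ge0 (normr_ge0 (x n)) (normr_ge0 (y n))).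
  + exact: (ler_normD (x n) (y n)).
- move=> k x /abs_summableP cx; apply/abs_summableP.
  rewrite (_ : (fun i => _) = `|k| *: (fun i => `|x i|)); last first.
    by apply/funext => i; exact: normrM.
  exact: is_cvg_seriesZ.
Qed.

HB.instance Definition _ :=
  GRing.SubChoice_isSubLmodule.Build R (nat -> R) _ l1 abs_summable_submod.

Definition l1_norm (x : l1) : R := limn [series `|x i|]_i.

Lemma l1_normD x y : l1_norm (x + y) <= l1_norm x + l1_norm y.
Proof.
rewrite /l1_norm -(lim_seriesD (l1_cvg x) (l1_cvg y)).
apply: lim_series_le; first exact: l1_cvg.
  by apply: is_cvg_seriesD; exact: l1_cvg.
by move=> n; exact: ler_normD.
Qed.

Lemma l1_normZ (k : R) x : l1_norm (k *: x) = `|k| * l1_norm x.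
Proof.
rewrite /l1_norm -[RHS](lim_seriesZ `|k| (l1_cvg x)).
by congr (limn (series _)); apply/funext => i; exact: normrM.
Qed.

Lemma l1_norm0_eq0 x : l1_norm x = 0 -> x = 0.
Proof.
move=> x0; apply/val_inj/funext => i /=.
have ndx : nondecreasing_seq [series `|x j|]_j.
  by apply: nondecreasing_series => j _ _; exact: normr_ge0.
have := nondecreasing_cvgn_le ndx (l1_cvg x) i.+1.
rewrite -/(l1_norm x) x0 /series/= big_nat_recr//= => h.
apply/eqP; rewrite -normr_le0; apply: le_trans h.
by rewrite lerDr sumr_ge0.
Qed.

HB.instance Definition _ :=
  Lmodule_isNormed.Build R l1 l1_normD l1_normZ l1_norm0_eq0.

Lemma l1_normE (x : l1) : `|x| = limn [series `|x i|]_i.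
Proof. by []. Qed.

Definition shift_seq (x : nat -> R) : nat -> R :=
  fun i => if i is j.+1 then x j else 0.

Lemma shift_abs_summable (x : l1) : shift_seq x \in @abs_summable R.
Proof.
apply/abs_summableP.
apply: (cvgP (limn [series `|x i|]_i)); rewrite -cvg_shiftS.
rewrite (_ : (fun n => _) = [series `|x i|]_i); first exact: l1_cvg.
by apply/funext => n; rewrite /series/= big_nat_recl//= normr0 add0r.
Qed.

Definition right_shift (x : l1) : l1 := L1 (shift_abs_summable x).

Lemma delta0_abs_summable : (fun i => (i == 0%N)%:R) \in @abs_summable R.
Proof. by apply: (@abs_summable_finite _ 1) => -[]. Qed.

Definition l1_delta0 : l1 := L1 delta0_abs_summable.

End l1_space.

Arguments l1_cvg {R} x.
Arguments l1_delta0 {R}.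

(* Main.v *)
Require Import Defs.
From mathcomp Require Import all_boot all_order all_algebra.
From mathcomp Require Import all_classical all_reals all_analysis.
From mathcomp Require Import complex ring lra.
Import Order.TTheory GRing.Theory Num.Theory.
Import numFieldNormedType.Exports.
Local Open Scope ring_scope.
Local Open Scope complex_scope.

(** The iterate [x n] is the law of a sum of [n] independent Bernoulli variables
    with parameters [alpha 0], ..., [alpha (n - 1)], so its generating function is
    the product of the polynomials [(1 - alpha k) + alpha k * 'X]
    ([coef_KM_genfun]), and [x n - T (x n)] has generating function
    [(1 - 'X)] times that product. Evaluating at a complex number [z] of modulus
    at most 1 can only decrease the l1 norm ([horner_le_l1_norm]), so the residual
    is bounded below by the modulus of
    [(1 - z) * \prod_k ((1 - alpha k) + alpha k * z)].

    Take [z = w ^+ 2] with [w = y + i t] on the unit circle. Since [1 / w] is the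
    conjugate of [w], dividing each factor by [w] leaves its modulus unchanged and
    makes it explicit: [1 - z] becomes [- 2 i t], of modulus [2 t]
    ([norm_residual_factor]), and [(1 - a) + a * z] becomes a number of real part
    [y], whatever [a] is ([norm_averaged_factor]). Hence the residual is at least
    [2 t y ^+ n]. The choice [t = 1 / sqrt (n + 1)], [y = sqrt (n / (n + 1))]
    maximizes this quantity on the unit circle, and it then suffices that
    [2 y ^+ n >= 1], a consequence of Bernoulli's inequality
    ([half_le_expr]). *)

Lemma l1_partial_sum_le (R : realType) (u : l1 R) (N : nat) :
  \sum_(i < N) `|u i| <= `|u|.
Proof.
have nd : nondecreasing_seq [series `|u i|]_i.
  by apply: nondecreasing_series => i _ _; exact: normr_ge0.
by have := nondecreasing_cvgn_le nd (l1_cvg u) N; rewrite /series/= big_mkord.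
Qed.

(** The triangle inequality for evaluation at a point of the closed unit disc;
    [Q] is the generating function of a finitely supported sequence [u]. *)
Lemma horner_le_l1_norm (R : realType) (u : l1 R) (Q : {poly R[i]}) (z : R[i]) :
  (forall i, Q`_i = (u i)%:C) -> `|z| <= 1 -> `|Q.[z]| <= `|u|%:C.
Proof.
move=> Qu z1; rewrite horner_coef; apply: le_trans (ler_norm_sum _ _ _) _.
apply: (@le_trans _ _ (\sum_(i < size Q) `|u i|)%:C); last first.
  by rewrite lecR l1_partial_sum_le.
rewrite rmorph_sum/=; apply: ler_sum => i _.
rewrite normrM normrX Qu normc_def/= expr0n/= addr0 sqrtr_sqr.
by rewrite ler_piMr ?exprn_ile1// lecR.
Qed.

(** Bernoulli's inequality gives [y ^+ n >= 1 - n (1 - y)]. The relation between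
    [n] and [y] turns [n (1 - y)] into [y ^+ 2 / (1 + y)], which is at most [1/2]
    because [2 y ^+ 2 - y - 1 = (2 y + 1) (y - 1) <= 0]. *)
Lemma half_le_expr (R : realFieldType) (y : R) (n : nat) :
  0 <= y -> n.+1%:R * y ^+ 2 = n%:R -> 1 <= 2 * y ^+ n.
Proof.
move=> y0 hy.
have bernoulli m : 1 + m%:R * (y - 1) <= y ^+ m.
  elim: m => [|m IH]; first by rewrite expr0 mul0r addr0.
  have m0 : 0 <= m%:R :> R by [].
  rewrite exprS -natr1.
  have := ler_wpM2l y0 IH; have := mulr_ge0 m0 (sqr_ge0 (y - 1)).
  by rewrite expr2; nra.
have n0 : 0 <= n%:R :> R by [].
have y1 : y <= 1.
  rewrite -(@expr_le1 _ 2)// -(ler_pM2l (ltr0Sn R n)) hy mulr1.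
  by rewrite ler_nat.
have hm : n%:R * (1 - y) <= 2^-1.
  have y1_gt0 : 0 < 1 + y by lra.
  rewrite -(ler_pM2r y1_gt0).
  have -> : n%:R * (1 - y) * (1 + y) = y ^+ 2.
    by move: hy; rewrite -natr1; lra.
  by have := mulr_ge0 y0 (_ : 0 <= 1 - y); rewrite expr2; nra.
by have := bernoulli n; lra.
Qed.

Section evaluation_point.
Variables (R : rcfType) (y t : R).
Hypothesis yt : y ^+ 2 + t ^+ 2 = 1.
Let w : R[i] := y +i* t.

Let y2 : y ^+ 2 = 1 - t ^+ 2.
Proof. by rewrite -yt addrK. Qed.

Lemma norm_half_angle : `|w| = 1.
Proof. by rewrite normc_def/= yt sqrtr1. Qed.

(** Dividing by [w] gives [(1 - a) w^* + a w], whose real part is [y] and whose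
    imaginary part is [(2 a - 1) t]. *)
Lemma norm_averaged_factor (a : R) :
  y%:C <= `|(1 - a)%:C + a%:C * w ^+ 2|.
Proof.
have -> : (1 - a)%:C + a%:C * w ^+ 2 = w * (y +i* ((2 * a - 1) * t)).
  apply/eqP; rewrite eq_complex/=; apply/andP; split; apply/eqP.
    by ring: y2.
  by ring.
rewrite normrM norm_half_angle mul1r; apply: le_trans (normc_ge_Re _).
by rewrite lecR ler_norm.
Qed.

(** Dividing by [w] gives [w^* - w], that is [- 2 i t]. *)
Lemma norm_residual_factor : `|1 - w ^+ 2| = (2 * `|t|)%:C.
Proof.
have -> : 1 - w ^+ 2 = w * (0 +i* (- 2 * t)).
  apply/eqP; rewrite eq_complex/=; apply/andP; split; apply/eqP.
    by ring: y2.
  by ring.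
rewrite normrM norm_half_angle mul1r normc_def/= expr0n/= add0r sqrtr_sqr.
by rewrite normrM normrN normr_nat.
Qed.
End evaluation_point.

Definition KM_genfun (R : rcfType) (alpha : nat -> R) (n : nat) : {poly R[i]} :=
  \prod_(k < n) ((1 - alpha k)%:C%:P + (alpha k)%:C *: 'X).

(** Multiplication by ['X] is the right shift on coefficients, so one averaged
    step is multiplication by [(1 - alpha n) + alpha n * 'X]. *)
Lemma coef_KM_genfun (R : realType) (alpha : nat -> R) (x : nat -> l1 R)
    (hx0 : x 0%N = l1_delta0)
    (hxS : forall n,
      x n.+1 = (1 - alpha n) *: x n + alpha n *: right_shift (x n))
    (n i : nat) :
  (KM_genfun R alpha n)`_i = (x n i)%:C.
Proof.
elim: n i => [|n IH] i.
  by rewrite /KM_genfun big_ord0 hx0 coef1/=; case: i.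
rewrite /KM_genfun big_ord_recr/= -/(KM_genfun _ _ _) hxS mulrDr coefD.
rewrite coefMC -scalerAr coefZ coefMX !IH.
have -> : ((1 - alpha n) *: x n + alpha n *: right_shift (x n)) i =
    (1 - alpha n) * x n i + alpha n * right_shift (x n) i by [].
rewrite [RHS]rmorphD/= !rmorphM/= mulrC.
by case: i.
Qed.

Theorem proposition3p2 (R : realType) (alpha : nat -> R) (x : nat -> l1 R)
    (halpha : forall n, 0 <= alpha n <= 1)
    (hx0 : x 0%N = l1_delta0)
    (hxS : forall n,
      x n.+1 = (1 - alpha n) *: x n + alpha n *: right_shift (x n))
    (n : nat) :
  `|x n - right_shift (x n)| >= 1 / Num.sqrt n.+1%:R.
Proof.
set t : R := 1 / Num.sqrt n.+1%:R; set y : R := Num.sqrt (n%:R / n.+1%:R).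
have n1 : n.+1%:R != 0 :> R by rewrite pnatr_eq0.
have t0 : 0 <= t by rewrite divr_ge0 ?sqrtr_ge0.
have y2 : y ^+ 2 = n%:R / n.+1%:R by rewrite sqr_sqrtr ?divr_ge0.
have yt : y ^+ 2 + t ^+ 2 = 1.
  by rewrite y2 expr_div_n expr1n sqr_sqrtr// -mulrDl natr1 divff.
have y0 : 0 <= y := sqrtr_ge0 _.
have hy : 1 <= 2 * y ^+ n.
  by apply: half_le_expr => //; rewrite y2 mulrC divfK.
pose z : R[i] := (y +i* t) ^+ 2.
have z1 : `|z| <= 1 by rewrite normrX norm_half_angle// expr1n.
pose Q := (1 - 'X) * KM_genfun R alpha n.
have coefQ i : Q`_i = ((x n - right_shift (x n)) i)%:C.
  rewrite /Q mulrBl mul1r coefB coefXM !(coef_KM_genfun _ _ _ hx0 hxS).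
  by case: i => [|i]; rewrite -rmorphB.
rewrite -lecR; apply: le_trans (horner_le_l1_norm _ _ _ _ coefQ z1).
rewrite hornerM normrM !hornerE (norm_residual_factor _ _ _ yt) (ger0_norm t0).
have genfun_ge : (y ^+ n)%:C <= `|(KM_genfun R alpha n).[z]|.
  rewrite horner_prod normr_prod rmorphXn/= -[n in _ ^+ n]card_ord.
  rewrite -prodr_const; apply: ler_prod => k _; rewrite lecR y0/=.
  rewrite hornerD hornerC hornerZ hornerX.
  exact: (norm_averaged_factor _ _ _ yt).
apply: le_trans (ler_wpM2l _ genfun_ge); last by rewrite lecR mulr_ge0.
by rewrite -rmorphM lecR/= mulrAC ler_peMl.
Qed.
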